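(* For every $\beta > 0$ and $\delta > 0$, there exists $C>0$ such that the following holds for every positive integer $n$. If $B \subseteq \{\pm 1\}^n$ is of size $2^{\beta n}$ and $Y \in B$ is uniformly distributed, then for all but at most $2^{n(1-\beta +\delta)}$ directions $x \in \{\pm 1\}^n$, $$\max_{k \in \mathbb{Z}} \Pr_Y[\langle x,Y\rangle=k] \leq \frac{C}{\sqrt{n}}.$$ In particular, if $X$ is independent of $Y$ and uniformly distributed in a set $A\subseteq\{\pm1\}^n$ of size $2^{n(1-\beta + 2\delta)}$, then $$\max_{k \in \mathbb{Z}} \Pr_{X,Y}[\langle X,Y\rangle=k] \leq \frac{C}{\sqrt{n}} + 2^{-\delta n}.$$
   Context: $\langle x,y\rangle=\sum_{j=1}^n x_jy_j$. *)

(* Defs.v *)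
From mathcomp Require Import all_boot all_order all_algebra.
From mathcomp Require Import all_classical all_reals all_analysis.

Set Implicit Arguments.
Unset Strict Implicit.
Unset Printing Implicit Defensive.

Import Order.TTheory GRing.Theory Num.Theory.

Local Open Scope ring_scope.

(* The cube {-1, 1}^n, with signs encoded by booleans: [false] stands for 1
   and [true] for -1. *)
Definition cube (n : nat) : finType := {ffun 'I_n -> bool}.

Definition coord (n : nat) (x : cube n) (j : 'I_n) : int := (-1) ^+ (x j).

Definition dotp (n : nat) (x y : cube n) : int :=
  \sum_(j < n) coord x j * coord y j.

(* Laws on a finite type are given by their probability mass functions. *)
Definition uniform_law (R : realType) (T : finType) (B : {set T}) : T -> R :=
  fun t => if t \in B then #|B|%:R^-1 else 0.

(* The joint law of two independent variables with laws mu and nu. *)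
Definition indep_law (R : realType) (S T : finType) (mu : S -> R) (nu : T -> R)
  : S * T -> R := fun p => mu p.1 * nu p.2.

Definition Pr (R : realType) (T : finType) (mu : T -> R) (E : pred T) : R :=
  \sum_(t | E t) mu t.

(* max_k Pr[f = k]; as f takes finitely many values, the supremum over all
   integers k is attained. *)
Definition max_point_prob (R : realType) (T : finType) (mu : T -> R)
    (f : T -> int) : R :=
  sup (range (fun k : int => Pr mu (fun t => f t == k))).

(* Main.v *)
(* Let f_th(x) = E_Y exp(i th <x,Y>) for Y uniform in B.  An even moment of |f_th|
   over all x in the cube tensorizes: splitting B by its first coordinate, the
   two values of the first coordinate of x rotate the two halves of the sum by
   opposite angles, so that the halves cannot be aligned for both values.  When
   m th^2 exceeds a constant depending on eta > 1, a two-point inequality turns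
   this into sum_x |f_th(x)|^(2m) <= (2 eta)^n / |B|.  By Markov's inequality,
   few x have |f_th(x)| > eta^(- n / (2m)), and n / m is of order n th^2.
   With J of order sqrt n, the angles th = d / (2J), 0 < d < J, thus give
   |f_th(x)| <= rho^d outside a small set of x, by a union bound.  The
   indicator of u = 0 is at most the Fejer kernel
   J^-2 |sum_(j < J) exp(i j u / (2J))|^2, so Pr[<x,Y> = k] is then at most
   J^-2 sum_(i, j < J) rho^|i - j| = O(1 / J), with no inversion formula. *)
Require Import Defs.
From mathcomp Require Import all_boot all_order all_algebra.
From mathcomp Require Import all_classical all_reals all_analysis.
From mathcomp Require Import ring lra zify.

Set Implicit Arguments.
Unset Strict Implicit.
Unset Printing Implicit Defensive.

Import Order.TTheory GRing.Theory Num.Theory.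
Import numFieldNormedType.Exports.

Local Open Scope ring_scope.

(** * The two-point inequality for real weights *)

Lemma convex_exprn (R : realFieldType) (a b X Y : R) (n : nat) :
  0 <= a -> 0 <= b -> a + b = 1 -> 0 <= X -> 0 <= Y ->
  (a * X + b * Y) ^+ n <= a * X ^+ n + b * Y ^+ n.
Proof.
move=> a0 b0 ab X0 Y0; elim: n => [|n IHn]; first by rewrite !expr0 !mulr1 ab.
have mono : 0 <= (X ^+ n - Y ^+ n) * (X - Y).
  have [XY|/ltW YX] := leP X Y.
    by apply: mulr_le0; rewrite subr_le0 // lerXn2r // nnegrE.
  by apply: mulr_ge0; rewrite subr_ge0 // lerXn2r // nnegrE.
have aXbY : 0 <= a * X + b * Y by rewrite addr_ge0 ?mulr_ge0.
rewrite exprSr; apply: le_trans (ler_wpM2r aXbY IHn) _.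
rewrite -subr_ge0 !exprSr.
(* The defect is a Chebyshev term, nonnegative because [X^n] and [Y^n] are ordered like [X] and [Y];
   the multiple of [1 - (a + b)] vanishes. *)
have -> : a * (X ^+ n * X) + b * (Y ^+ n * Y) -
    (a * X ^+ n + b * Y ^+ n) * (a * X + b * Y) =
    a * b * ((X ^+ n - Y ^+ n) * (X - Y)) +
    (1 - (a + b)) * (a * X ^+ n * X + b * Y ^+ n * Y) by ring.
by rewrite ab subrr mul0r addr0 (mulr_ge0 (mulr_ge0 a0 b0) mono).
Qed.

(** Serves in place of an exponential bound: decay of order [1 / (n z)] is enough below.
    Inductively, [(1 - z) (1 + (n + 1) z) <= 1 + n z]. *)
Lemma exprn_le_inv (R : realFieldType) (z : R) (n : nat) :
  0 <= z <= 1 -> (1 - z) ^+ n * (1 + n%:R * z) <= 1.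
Proof.
move=> /andP[z0 z1]; elim: n => [|n IHn]; first by rewrite expr0 mul0r addr0 mulr1.
apply: le_trans IHn; rewrite exprSr -mulrA ler_wpM2l ?exprn_ge0 ?subr_ge0 //.
have : 0 <= z * z * (n.+1)%:R by rewrite !mulr_ge0.
rewrite -natr1; nra.
Qed.

(* A weight b that is tiny compared with s can be absorbed: either b Y <= s X,
   or Y^4 is so large that b^2 Y^4 alone dominates.  Exponent 2 would not do. *)
Lemma unbalanced4 (R : realFieldType) (eta s a b X Y : R) :
  0 < s < 1 -> (1 + s) ^+ 4 <= eta * (1 - s) ^+ 2 -> 1 <= eta ->
  0 <= a -> 0 <= b -> a + b = 1 -> 0 <= X -> 0 <= Y ->
  b * (1 + s) ^+ 2 <= s ^+ 2 ->
  (a * X + b * Y) ^+ 4 <= eta * (a ^+ 2 * X ^+ 4 + b ^+ 2 * Y ^+ 4).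
Proof.
move=> /andP[s0 s1] seta eta1 a0 b0 ab X0 Y0 bs.
have bs1 : b <= s.
  have : 0 <= b * (s * (2 + s)) by rewrite !mulr_ge0 // ?addr_ge0 // ltW.
  nra.
have aE : a = 1 - b by rewrite -ab addrK.
have aX0 : 0 <= a * X by rewrite mulr_ge0.
have bY0 : 0 <= b * Y by rewrite mulr_ge0.
have S0 : 0 <= a ^+ 2 * X ^+ 4 /\ 0 <= b ^+ 2 * Y ^+ 4.
  by split; rewrite mulr_ge0 ?exprn_ge0.
have eta0 : 0 <= eta by lra.
have [bYsX|sXbY] := leP (b * Y) (s * X).
  have h : a * X + b * Y <= (1 + s) * X.
    by rewrite mulrDl lerD // ler_wpM2r // aE gerBl.
  apply: (@le_trans _ _ (((1 + s) * X) ^+ 4)).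
    by rewrite lerXn2r // nnegrE; [rewrite addr_ge0 | apply: le_trans h; rewrite addr_ge0].
  rewrite exprMn; apply: le_trans (ler_wpM2r (exprn_ge0 4 X0) seta) _.
  rewrite -mulrA ler_wpM2l //.
  (* Since [b <= s], the factor [(1 - s)^2] is at most [a^2]. *)
  apply: (@le_trans _ _ (a ^+ 2 * X ^+ 4)); last by rewrite lerDl; case: S0.
  rewrite ler_wpM2r ?exprn_ge0 // lerXn2r ?nnegrE // ?subr_ge0; lra.
have h : s * (a * X + b * Y) <= (1 + s) * (b * Y).
  have : s * (a * X) <= s * X by rewrite ler_wpM2l ?(ltW s0) // ler_piMl //; lra.
  lra.
apply: (@le_trans _ _ (b ^+ 2 * Y ^+ 4)); last first.
  apply: le_trans (_ : a ^+ 2 * X ^+ 4 + b ^+ 2 * Y ^+ 4 <= _).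
    by rewrite lerDr; case: S0.
  by apply: ler_peMl => //; rewrite addr_ge0; case: S0.
have s40 : 0 < s ^+ 4 by rewrite exprn_gt0.
rewrite -(ler_pM2l s40) -exprMn.
apply: (@le_trans _ _ (((1 + s) * (b * Y)) ^+ 4)).
  rewrite lerXn2r // nnegrE; first by rewrite mulr_ge0 ?addr_ge0 // ltW.
  by rewrite mulr_ge0 // addr_ge0 // ltW.
(* The fourth power leaves a spare [b^2], which [bs], squared, trades for [s^4]. *)
have -> : ((1 + s) * (b * Y)) ^+ 4 = (b * (1 + s) ^+ 2) ^+ 2 * (b ^+ 2 * Y ^+ 4).
  by ring.
have -> : s ^+ 4 = (s ^+ 2) ^+ 2 by ring.
rewrite ler_wpM2r ?lerXn2r ?nnegrE ?exprn_ge0 //; first by case: S0.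
  by rewrite mulr_ge0 ?exprn_ge0 ?addr_ge0 // ltW.
by rewrite ltW.
Qed.

(** Reduces to exponent 4: by convexity [(a X + b Y)^t <= a X^t + b Y^t], and [unbalanced4] applies
    to [X^t] and [Y^t]. *)
Lemma unbalanced (R : realFieldType) (eta s a b X Y : R) (t : nat) :
  0 < s < 1 -> (1 + s) ^+ 4 <= eta * (1 - s) ^+ 2 -> 1 <= eta ->
  0 <= a -> 0 <= b -> a + b = 1 -> 0 <= X -> 0 <= Y ->
  b * (1 + s) ^+ 2 <= s ^+ 2 ->
  (a * X + b * Y) ^+ (4 * t) <=
    eta * (a ^+ 2 * X ^+ (4 * t) + b ^+ 2 * Y ^+ (4 * t)).
Proof.
move=> s01 seta eta1 a0 b0 ab X0 Y0 bs.
rewrite mulnC !exprM.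
apply: le_trans (unbalanced4 s01 seta eta1 a0 b0 ab _ _ bs); rewrite ?exprn_ge0 //.
rewrite lerXn2r ?nnegrE ?convex_exprn //; last by rewrite addr_ge0 ?mulr_ge0 ?exprn_ge0.
by rewrite exprn_ge0 // addr_ge0 ?mulr_ge0.
Qed.

(** Let [S] be the bracket on the right. If [2 Y <= X], the average [a X + b Y] is so far below [X]
    that its power is at most [S], and the second summand is no larger. Otherwise the first summand
    is at most [2 S] by convexity, and the loss due to [g] makes the second at most [eta - 1] times
    the first. *)
Lemma balanced_ge (R : realFieldType) (eta c g a b X Y : R) (t : nat) :
  0 < c < 1 -> 1 < eta -> 0 <= g <= 1 ->
  1 <= t%:R * (1 - g) * c ^+ 3 ->
  1 <= t%:R * (1 - g) * (c ^+ 2 * (eta - 1)) ->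
  c <= a -> c <= b -> a + b = 1 -> 0 <= Y -> Y <= X ->
  (a * X + b * Y) ^+ (4 * t) +
    (a ^+ 2 * X ^+ 2 + b ^+ 2 * Y ^+ 2 + 2 * g * (a * b * X * Y)) ^+ (2 * t)
  <= 2 * eta * (a ^+ 2 * X ^+ (4 * t) + b ^+ 2 * Y ^+ (4 * t)).
Proof.
move=> /andP[c0 c1] eta1 /andP[g0 g1] tc teta ca cb ab Y0 YX.
have X0 : 0 <= X by apply: le_trans YX.
have a0 : 0 <= a by lra.
have b0 : 0 <= b by lra.
have XY0 : 0 <= a * b * X * Y by rewrite !mulr_ge0.
have aXbY0 : 0 <= a * X + b * Y by rewrite addr_ge0 ?mulr_ge0.
have q0 : 0 <= a ^+ 2 * X ^+ 2 + b ^+ 2 * Y ^+ 2 + 2 * g * (a * b * X * Y).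
  by rewrite !addr_ge0 ?mulr_ge0 ?exprn_ge0.
have qle : a ^+ 2 * X ^+ 2 + b ^+ 2 * Y ^+ 2 + 2 * g * (a * b * X * Y)
   = (a * X + b * Y) ^+ 2 - 2 * (1 - g) * (a * b * X * Y) by ring.
set S := a ^+ 2 * X ^+ (4 * t) + b ^+ 2 * Y ^+ (4 * t).
have S0 : 0 <= S by rewrite addr_ge0 ?mulr_ge0 ?exprn_ge0.
have t0 : 0 <= t%:R :> R by [].
have [XbigY|XsmallY] := leP (2 * Y) X.
  have first_le : (a * X + b * Y) ^+ (4 * t) <= S.
    have h : a * X + b * Y <= (1 - c / 2) * X.
      have : b * Y * 2 <= b * X by rewrite -mulrA ler_wpM2l // mulrC.
      have : c * X <= b * X by rewrite ler_wpM2r.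
      have : a * X = X - b * X by rewrite -{2}[X]mul1r -ab; ring.
      lra.
    apply: (@le_trans _ _ (((1 - c / 2) * X) ^+ (4 * t))).
      rewrite lerXn2r // nnegrE; exact: le_trans h.
    rewrite exprMn /S.
    apply: (@le_trans _ _ (a ^+ 2 * X ^+ (4 * t))); last first.
      by rewrite lerDl mulr_ge0 ?exprn_ge0.
    rewrite ler_wpM2r ?exprn_ge0 //.
    have hz : 0 <= c / 2 <= 1 by lra.
    have := exprn_le_inv (4 * t) hz; rewrite natrM => hp.
    have p0 : 0 <= (1 - c / 2) ^+ (4 * t) by rewrite exprn_ge0; lra.
    have tc' : 1 <= t%:R * c ^+ 3.
      apply: le_trans tc _; rewrite ler_wpM2r ?exprn_ge0 ?(ltW c0) //.
      by rewrite ler_piMr //; lra.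
    have : c ^+ 2 <= a ^+ 2 by rewrite lerXn2r ?nnegrE ?(ltW c0).
    apply: le_trans.
    set p := (1 - c / 2) ^+ (4 * t) in hp p0 *.
    have c20 : 0 < c ^+ 2 by rewrite exprn_gt0.
    have h1 : p * (t%:R * c ^+ 3) <= c ^+ 2.
      have := ler_wpM2r (ltW c20) hp.
      have : 0 <= p * c ^+ 2 by rewrite mulr_ge0 // ltW.
      have : 0 <= p * (t%:R * c ^+ 3) by rewrite !mulr_ge0 // ltW.
      have -> : p * (1 + 4%:R * t%:R * (c / 2)) * c ^+ 2 =
        p * c ^+ 2 + 2 * (p * (t%:R * c ^+ 3)) by field.
      lra.
    by apply: le_trans h1; rewrite ler_peMr.
  have second_le : (a ^+ 2 * X ^+ 2 + b ^+ 2 * Y ^+ 2 + 2 * g * (a * b * X * Y)) ^+ (2 * t)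
       <= (a * X + b * Y) ^+ (4 * t).
    have -> : (4 * t = 2 * (2 * t))%N by rewrite mulnA.
    rewrite [leRHS]exprM lerXn2r ?nnegrE ?exprn_ge0 // qle.
    by rewrite gerBl !mulr_ge0 // subr_ge0.
  have : S <= eta * S by rewrite ler_peMl // ltW.
  lra.
set T := (a * X + b * Y) ^+ (4 * t).
have T0 : 0 <= T by rewrite exprn_ge0.
(* Convexity is used at exponent [2 t], so that squaring produces the weights [a^2] and [b^2]; then
   [(u + v)^2 <= 2 (u^2 + v^2)]. *)
have TS : T <= 2 * S.
  have : T <= (a * X ^+ (2 * t) + b * Y ^+ (2 * t)) ^+ 2.
    rewrite /T; have -> : (4 * t = (2 * t) * 2)%N by rewrite mulnAC.
    rewrite [X in X <= _]exprM.
    rewrite lerXn2r ?nnegrE ?exprn_ge0 ?convex_exprn //.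
    by rewrite addr_ge0 ?mulr_ge0 ?exprn_ge0.
  have -> : S = (a * X ^+ (2 * t)) ^+ 2 + (b * Y ^+ (2 * t)) ^+ 2.
    by rewrite /S !exprMn -!exprM; congr (_ * _ ^+ _ + _ * _ ^+ _); rewrite [RHS]mulnAC.
  have := sqr_ge0 (a * X ^+ (2 * t) - b * Y ^+ (2 * t)); nra.
(* A lower bound for the relative loss [2 (1 - g) a b X Y / (a X + b Y)^2], as [a b >= c^2] and
   [2 Y >= X >= a X + b Y]. *)
set z := c ^+ 2 * (1 - g).
have hz : 0 <= z <= 1.
  rewrite mulr_ge0 ?exprn_ge0 ?subr_ge0 ?(ltW c0) //=.
  have : c ^+ 2 <= 1 by rewrite exprn_ile1 // ltW.
  rewrite /z; have : 0 <= c ^+ 2 by rewrite exprn_ge0 // ltW.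
  nra.
have q_le : a ^+ 2 * X ^+ 2 + b ^+ 2 * Y ^+ 2 + 2 * g * (a * b * X * Y)
    <= (1 - z) * (a * X + b * Y) ^+ 2.
  rewrite qle mulrBl mul1r lerB // /z.
  have -> : c ^+ 2 * (1 - g) * (a * X + b * Y) ^+ 2 =
            (1 - g) * (c ^+ 2 * (a * X + b * Y) ^+ 2) by ring.
  have -> : 2 * (1 - g) * (a * b * X * Y) = (1 - g) * (a * b * (X * (2 * Y))) by ring.
  rewrite ler_wpM2l ?subr_ge0 //.
  apply: ler_pM; rewrite ?exprn_ge0 ?(ltW c0) //.
    by rewrite expr2 ler_pM // ltW.
  have h : a * X + b * Y <= X.
    by rewrite -[leRHS]mul1r -ab mulrDl lerD2l ler_wpM2l.
  apply: (@le_trans _ _ (X ^+ 2)); first by rewrite lerXn2r ?nnegrE.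
  by rewrite expr2 ler_wpM2l // ltW.
have second_le : (a ^+ 2 * X ^+ 2 + b ^+ 2 * Y ^+ 2 + 2 * g * (a * b * X * Y)) ^+ (2 * t)
    <= (eta - 1) * T.
  apply: (@le_trans _ _ (((1 - z) * (a * X + b * Y) ^+ 2) ^+ (2 * t))).
    by rewrite lerXn2r ?nnegrE //; apply: le_trans q_le.
  rewrite exprMn -exprM mulnA -/T ler_wpM2r //.
  have := exprn_le_inv (2 * t) hz; rewrite natrM.
  have p0 : 0 <= (1 - z) ^+ (2 * t) by rewrite exprn_ge0 //; lra.
  set p := (1 - z) ^+ (2 * t) in p0 *.
  have teta' : 1 <= t%:R * z * (eta - 1) by move: teta; rewrite /z; lra.
  have tz0 : 0 <= t%:R * z by rewrite mulr_ge0 //; case/andP: hz.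
  move=> hp.
  have h1 : p * (t%:R * z) <= 1.
    have : 0 <= p * (t%:R * z) by rewrite mulr_ge0.
    lra.
  have := ler_wpM2l p0 teta'; rewrite mulr1 => /le_trans; apply.
  rewrite mulrA ler_piMl //; lra.
have : (eta - 1) * T <= (eta - 1) * (2 * S) by rewrite ler_wpM2l //; lra.
rewrite -/T; lra.
Qed.

(* The two summands are the bounds on the two rotated sums: the first sum may
   be perfectly aligned, the cosine of the angle in the second is at most g. *)
Lemma two_point (R : realFieldType) (eta : R) : 1 < eta ->
  exists2 K : R, 0 < K & forall (t : nat) (g a b X Y : R),
    0 <= g <= 1 -> K <= t%:R * (1 - g) ->
    0 <= a -> 0 <= b -> a + b = 1 -> 0 <= X -> 0 <= Y ->
    (a * X + b * Y) ^+ (4 * t) +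
      (a ^+ 2 * X ^+ 2 + b ^+ 2 * Y ^+ 2 + 2 * g * (a * b * X * Y)) ^+ (2 * t)
    <= 2 * eta * (a ^+ 2 * X ^+ (4 * t) + b ^+ 2 * Y ^+ (4 * t)).
Proof.
(* Capping [eta] at 2 gives [s <= 1/32], where the linear term of [(1 + 32 s) (1 - s)^2], namely
   [30 s], dominates all that follows the 1 in [(1 + s)^4]. *)
move=> eta1; pose e := Num.min eta 2; pose s := (e - 1) / 32.
have e1 : 1 < e by rewrite lt_min eta1 ltr1n.
have e2 : e <= 2 by rewrite ge_min lexx orbT.
have ee : e <= eta by rewrite ge_min lexx.
have s01 : 0 < s < 1 by rewrite /s; lra.
have eE : e = 1 + 32 * s by rewrite /s; field.
have s32 : s <= 1 / 32 by rewrite /s; lra.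
have [s0 s1] := andP s01.
have se : (1 + s) ^+ 4 <= eta * (1 - s) ^+ 2.
  apply: (@le_trans _ _ (e * (1 - s) ^+ 2)); last by rewrite ler_wpM2r ?exprn_ge0 //; lra.
  have ss : 0 <= s ^+ 2 by rewrite exprn_ge0 // ltW.
  have s2 : s ^+ 2 <= s / 32 by rewrite expr2; nra.
  have s3 : s ^+ 3 <= s ^+ 2 by rewrite exprSr ler_piMr // ltW.
  have s4 : s ^+ 4 <= s ^+ 2.
    by apply: le_trans s3; rewrite exprSr ler_piMr ?exprn_ge0 // ltW.
  have s3' : 0 <= s ^+ 3 by rewrite exprn_ge0 // ltW.
  have -> : (1 + s) ^+ 4 = 1 + 4 * s + 6 * s ^+ 2 + 4 * s ^+ 3 + s ^+ 4 by ring.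
  have -> : e * (1 - s) ^+ 2 = 1 + 30 * s - 63 * s ^+ 2 + 32 * s ^+ 3.
    by rewrite eE; ring.
  lra.
have s1p : 0 < (1 + s) ^+ 2 by rewrite exprn_gt0 //; lra.
(* Below the threshold c a weight counts as tiny. *)
pose c := s ^+ 2 / (1 + s) ^+ 2.
have c0 : 0 < c by rewrite divr_gt0 // exprn_gt0.
have c1 : c < 1.
  rewrite /c ltr_pdivrMr // mul1r; nra.
have c30 : 0 < c ^+ 3 by rewrite exprn_gt0.
have c2e0 : 0 < c ^+ 2 * (eta - 1) by rewrite mulr_gt0 ?exprn_gt0 //; lra.
exists ((c ^+ 3)^-1 + (c ^+ 2 * (eta - 1))^-1); first by rewrite addr_gt0 ?invr_gt0.
move=> t g a b X Y g01 Kt a0 b0 ab X0 Y0.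
have tc : 1 <= t%:R * (1 - g) * c ^+ 3.
  by rewrite -ler_pdivrMr // mul1r; apply: le_trans Kt; rewrite lerDl invr_ge0 ltW.
have te : 1 <= t%:R * (1 - g) * (c ^+ 2 * (eta - 1)).
  by rewrite -ler_pdivrMr // mul1r; apply: le_trans Kt; rewrite lerDr invr_ge0 ltW.
have c01 : 0 < c < 1 by rewrite c0.
(* For a tiny weight the factor 2 pays for bounding the second summand by the first, so the angle
   does not matter. *)
have both T : (a * X + b * Y) ^+ (4 * t) <= eta * T ->
    (a * X + b * Y) ^+ (4 * t) +
      (a ^+ 2 * X ^+ 2 + b ^+ 2 * Y ^+ 2 + 2 * g * (a * b * X * Y)) ^+ (2 * t)
      <= 2 * eta * T.
  move=> h; have := g01 => /andP[g0 g1].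
  have : (a ^+ 2 * X ^+ 2 + b ^+ 2 * Y ^+ 2 + 2 * g * (a * b * X * Y)) ^+ (2 * t)
       <= (a * X + b * Y) ^+ (4 * t).
    have -> : (4 * t = 2 * (2 * t))%N by rewrite mulnA.
    have abXY : 0 <= a * b * X * Y by rewrite !mulr_ge0.
    rewrite [leRHS]exprM lerXn2r ?nnegrE ?exprn_ge0 ?addr_ge0 ?mulr_ge0 ?exprn_ge0 //.
    have -> : (a * X + b * Y) ^+ 2 =
      a ^+ 2 * X ^+ 2 + b ^+ 2 * Y ^+ 2 + 2 * (a * b * X * Y) by ring.
    by rewrite lerD2l -mulrA ler_wpM2l // ler_piMl.
  lra.
have [bc|cb] := leP b c.
  by apply: both; apply: (unbalanced t s01) => //; [lra | rewrite -ler_pdivlMr].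
have [ac|ca] := leP a c.
  apply: both; rewrite [in leLHS]addrC [in leRHS]addrC.
  by apply: (unbalanced t s01) => //; [lra | rewrite addrC | rewrite -ler_pdivlMr].
have [YX|/ltW XY] := leP Y X.
  by apply: (balanced_ge c01 eta1 g01 tc te) => //; apply: ltW.
have -> : a * X + b * Y = b * Y + a * X by rewrite addrC.
have -> : a ^+ 2 * X ^+ 2 + b ^+ 2 * Y ^+ 2 + 2 * g * (a * b * X * Y) =
  b ^+ 2 * Y ^+ 2 + a ^+ 2 * X ^+ 2 + 2 * g * (b * a * Y * X) by ring.
rewrite [in leRHS]addrC.
by apply: (balanced_ge c01 eta1 g01 tc te); rewrite ?(ltW ca) ?(ltW cb) // addrC.
Qed.

(** * Two plane vectors rotated by opposite angles *)

(** With [k = cos th] and [h = sin th], vectors of lengths [U], [V] at angle [phi] are rotated by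
    [th] and [- th], or the reverse. The squared lengths of the two sums have cross terms
    [2 U V cos(phi + 2 th)] and [2 U V cos(phi - 2 th)]. The larger is at most [2 U V], and the
    smaller at most [2 U V cos(2 th)], where [cos(2 th) = k^2 - h^2]. *)
Lemma sum_two_phases (R : rcfType) (c0 s0 c1 s1 k h U V : R) (m : nat) :
  k ^+ 2 + h ^+ 2 = 1 -> 0 <= k ^+ 2 - h ^+ 2 -> 0 <= U -> 0 <= V ->
  U ^+ 2 = c0 ^+ 2 + s0 ^+ 2 -> V ^+ 2 = c1 ^+ 2 + s1 ^+ 2 ->
  ((k * (c0 + c1) - h * (s0 - s1)) ^+ 2 +
     (k * (s0 + s1) + h * (c0 - c1)) ^+ 2) ^+ m +
  ((k * (c0 + c1) + h * (s0 - s1)) ^+ 2 +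
     (k * (s0 + s1) - h * (c0 - c1)) ^+ 2) ^+ m <=
  (U + V) ^+ (2 * m) + (U ^+ 2 + V ^+ 2 + 2 * (k ^+ 2 - h ^+ 2) * (U * V)) ^+ m.
Proof.
move=> kh g0 U0 V0 UE VE.
(* Replacing th by - th exchanges the two terms. *)
wlog hb : h s0 s1 c0 c1 kh g0 UE VE / 0 <= k * h * (s0 * c1 - c0 * s1).
  move=> H; have [/H|/ltW neg] := leP 0 (k * h * (s0 * c1 - c0 * s1)); first exact.
  rewrite addrC; have := H (- h) s0 s1 c0 c1; rewrite sqrrN !mulNr !opprK.
  by apply=> //; rewrite mulrN mulNr oppr_ge0.
have UV0 : 0 <= U * V by rewrite mulr_ge0.
set A := c0 * c1 + s0 * s1.
set D := s0 * c1 - c0 * s1 in hb.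
have AD : A ^+ 2 + D ^+ 2 = (U * V) ^+ 2.
  by rewrite exprMn UE VE /A /D; ring.
have -> : (k * (c0 + c1) - h * (s0 - s1)) ^+ 2 + (k * (s0 + s1) + h * (c0 - c1)) ^+ 2
   = U ^+ 2 + V ^+ 2 + 2 * ((k ^+ 2 - h ^+ 2) * A - 2 * (k * h * D)).
  have -> : U ^+ 2 + V ^+ 2 = (k ^+ 2 + h ^+ 2) * (U ^+ 2 + V ^+ 2) by rewrite kh mul1r.
  by rewrite UE VE /A /D; ring.
have -> : (k * (c0 + c1) + h * (s0 - s1)) ^+ 2 + (k * (s0 + s1) - h * (c0 - c1)) ^+ 2
   = U ^+ 2 + V ^+ 2 + 2 * ((k ^+ 2 - h ^+ 2) * A + 2 * (k * h * D)).
  have -> : U ^+ 2 + V ^+ 2 = (k ^+ 2 + h ^+ 2) * (U ^+ 2 + V ^+ 2) by rewrite kh mul1r.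
  by rewrite UE VE /A /D; ring.
have bound (w : R) : w ^+ 2 <= (U * V) ^+ 2 -> - (U * V) <= w <= U * V.
  by move=> ?; rewrite -ler_norml -ler_sqr ?nnegrE // real_normK ?num_real.
have /bound/andP[_ A_le] : A ^+ 2 <= (U * V) ^+ 2 by rewrite -AD lerDl sqr_ge0.
(* Cauchy-Schwarz with the unit vector [(k^2 - h^2, 2 k h)], whose entries are [cos(2 th)] and
   [sin(2 th)]; [z] is a sign. *)
have cauchy (z : R) : z ^+ 2 = 1 ->
    ((k ^+ 2 - h ^+ 2) * A + z * (2 * (k * h * D))) ^+ 2 <= (U * V) ^+ 2.
  move=> z1; have -> : (U * V) ^+ 2 = (k ^+ 2 + h ^+ 2) ^+ 2 * (A ^+ 2 + D ^+ 2).
    by rewrite kh expr1n mul1r.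
  rewrite -subr_ge0.
  have -> : (k ^+ 2 + h ^+ 2) ^+ 2 * (A ^+ 2 + D ^+ 2) -
      ((k ^+ 2 - h ^+ 2) * A + z * (2 * (k * h * D))) ^+ 2 =
     (2 * k * h * A - z * (k ^+ 2 - h ^+ 2) * D) ^+ 2 +
     (1 - z ^+ 2) * (((k ^+ 2 - h ^+ 2) * D) ^+ 2 + (2 * k * h * D) ^+ 2) by ring.
  by rewrite z1 subrr mul0r addr0 sqr_ge0.
have /cauchy/bound/andP[] : (1 : R) ^+ 2 = 1 by rewrite expr1n.
have /cauchy/bound/andP[] : (-1 : R) ^+ 2 = 1 by rewrite sqrrN expr1n.
rewrite mul1r mulN1r => lo1 _ lo2 hi2.
have sq0 : 0 <= (U - V) ^+ 2 by rewrite sqr_ge0.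
have sqE : (U - V) ^+ 2 = U ^+ 2 + V ^+ 2 - 2 * (U * V) by ring.
have gA : (k ^+ 2 - h ^+ 2) * A <= (k ^+ 2 - h ^+ 2) * (U * V) by rewrite ler_wpM2l.
have gUV : 0 <= (k ^+ 2 - h ^+ 2) * (U * V) by rewrite mulr_ge0.
rewrite addrC exprM; apply: lerD; rewrite lerXn2r ?nnegrE ?sqr_ge0 //.
- lra.
- by rewrite (_ : (U + V) ^+ 2 = U ^+ 2 + V ^+ 2 + 2 * (U * V)); [lra | ring].
- lra.
- by have := sqr_ge0 U; have := sqr_ge0 V; lra.
- lra.
Qed.

(** * Splitting the cube by the first coordinate *)

Definition cube_cons (n : nat) (b : bool) (y : cube n) : cube n.+1 :=
  [ffun i => if unlift ord0 i is Some j then y j else b].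

Lemma dotp_cons (n : nat) (a b : bool) (x y : cube n) :
  dotp (cube_cons a x) (cube_cons b y) = (-1) ^+ a * (-1) ^+ b + dotp x y.
Proof.
rewrite /dotp big_ord_recl /Defs.coord /cube_cons !ffunE unlift_none; congr (_ + _).
by apply: eq_bigr => i _; rewrite !ffunE liftK.
Qed.

Lemma sum_cube_cons (R : nmodType) (n : nat) (F : cube n.+1 -> R) :
  \sum_x F x = \sum_(x : cube n) F (cube_cons false x) +
               \sum_(x : cube n) F (cube_cons true x).
Proof.
rewrite (reindex (fun p : bool * cube n => cube_cons p.1 p.2)) /=.
  rewrite -(pair_bigA _ (fun b y => F (cube_cons b y))) /= big_bool /=.
  by rewrite addrC.
exists (fun z : cube n.+1 => (z ord0, [ffun j => z (lift ord0 j)] : cube n)).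
  move=> [b y] _ /=; congr pair; first by rewrite ffunE unlift_none.
  by apply/ffunP => j; rewrite !ffunE liftK.
move=> z _; apply/ffunP => i; rewrite !ffunE /=.
by case: unliftP => [j ->|->] //; rewrite ffunE.
Qed.

Definition slice (n : nat) (b : bool) (B : {set cube n.+1}) : {set cube n} :=
  [set y | cube_cons b y \in B].

Lemma sum_slice (R : nmodType) (n : nat) (B : {set cube n.+1}) (F : cube n.+1 -> R) :
  \sum_(y in B) F y = \sum_(y in slice false B) F (cube_cons false y) +
                      \sum_(y in slice true B) F (cube_cons true y).
Proof.
rewrite big_mkcond sum_cube_cons; congr (_ + _); rewrite [RHS]big_mkcond /=;
  by apply: eq_bigr => y _; rewrite inE.
Qed.

Lemma card_slice (n : nat) (B : {set cube n.+1}) :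
  (#|B| = #|slice false B| + #|slice true B|)%N.
Proof. by rewrite -!sum1_card sum_slice. Qed.

(** * Even moments of the characteristic function *)

(** With [sin_sum], the real and imaginary parts of the sum of [exp(i th <x,y>)] over [y] in [B]. *)
Definition cos_sum (R : realType) (n : nat) (th : R) (B : {set cube n}) (x : cube n) : R :=
  \sum_(y in B) cos (th * (dotp x y)%:~R).

Definition sin_sum (R : realType) (n : nat) (th : R) (B : {set cube n}) (x : cube n) : R :=
  \sum_(y in B) sin (th * (dotp x y)%:~R).

(** The [false] slice is rotated by the angle [(-1)^a th] and the [true] slice by its opposite. *)
Lemma cos_sum_cons (R : realType) (n : nat) (th : R) (B : {set cube n.+1}) (a : bool) x :
  cos_sum th B (cube_cons a x) =
  cos th * (cos_sum th (slice false B) x + cos_sum th (slice true B) x) -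
  (-1) ^+ a * sin th * (sin_sum th (slice false B) x - sin_sum th (slice true B) x).
Proof.
rewrite /cos_sum /sin_sum sum_slice mulrDr mulrBr !mulr_sumr opprD opprK addrACA -sumrN -!big_split.
congr (_ + _); apply: eq_bigr => y _; rewrite dotp_cons intrD mulrDr cosD.
- by case: a; rewrite !(expr0, expr1, mulr1, mul1r, mulN1r, mulrN1, mulrN, cosN, sinN, mulNr).
- by case: a; rewrite !(expr0, expr1, mulr1, mul1r, mulN1r, mulrN1, mulrN, cosN, sinN, mulNr, opprK).
Qed.

Lemma sin_sum_cons (R : realType) (n : nat) (th : R) (B : {set cube n.+1}) (a : bool) x :
  sin_sum th B (cube_cons a x) =
  cos th * (sin_sum th (slice false B) x + sin_sum th (slice true B) x) +
  (-1) ^+ a * sin th * (cos_sum th (slice false B) x - cos_sum th (slice true B) x).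
Proof.
rewrite /cos_sum /sin_sum sum_slice mulrDr mulrBr !mulr_sumr addrACA -sumrN -!big_split.
congr (_ + _); apply: eq_bigr => y _; rewrite dotp_cons intrD mulrDr sinD addrC.
- by case: a; rewrite !(expr0, expr1, mulr1, mul1r, mulN1r, mulrN1, mulrN, cosN, sinN, mulNr).
- by case: a; rewrite !(expr0, expr1, mulr1, mul1r, mulN1r, mulrN1, mulrN, cosN, sinN, mulNr, opprK).
Qed.

(* The squared modulus of E_Y exp(i th <x,Y>), Y uniform in B (0 if B is empty). *)
Definition charfun_sq (R : realType) (n : nat) (th : R) (B : {set cube n}) (x : cube n) : R :=
  (cos_sum th B x ^+ 2 + sin_sum th B x ^+ 2) / #|B|%:R ^+ 2.

Lemma charfun_sq_ge0 (R : realType) (n : nat) (th : R) (B : {set cube n}) (x : cube n) :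
  0 <= charfun_sq th B x.
Proof. by rewrite mulr_ge0 ?invr_ge0 ?addr_ge0 ?sqr_ge0. Qed.

Lemma charfun_sqM (R : realType) (n : nat) (th : R) (B : {set cube n}) (x : cube n) :
  #|B|%:R ^+ 2 * charfun_sq th B x = cos_sum th B x ^+ 2 + sin_sum th B x ^+ 2.
Proof.
have [->|B0] := eqVneq B finset.set0.
  by rewrite /cos_sum /sin_sum !big_set0 cards0 expr0n mul0r addr0.
by rewrite mulrC divfK // expf_neq0 // pnatr_eq0 cards_eq0.
Qed.

(** Holds pointwise in the remaining coordinates [x]: the two extensions of [x] yield the two
    rotated sums of [sum_two_phases], with [U = a X] and [V = b Y], where [a], [b] are the
    proportions of the slices and [X], [Y] the moduli of their characteristic functions. *)
Lemma charfun_moment_step (R : realType) (eta th : R) (t n : nat) (B : {set cube n.+1}) :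
  (forall (a b X Y : R), 0 <= a -> 0 <= b -> a + b = 1 -> 0 <= X -> 0 <= Y ->
    (a * X + b * Y) ^+ (4 * t) + (a ^+ 2 * X ^+ 2 + b ^+ 2 * Y ^+ 2 +
       2 * (cos th ^+ 2 - sin th ^+ 2) * (a * b * X * Y)) ^+ (2 * t)
    <= 2 * eta * (a ^+ 2 * X ^+ (4 * t) + b ^+ 2 * Y ^+ (4 * t))) ->
  0 <= cos th ^+ 2 - sin th ^+ 2 -> B != finset.set0 ->
  \sum_x charfun_sq th B x ^+ (2 * t) <=
    2 * eta * ((#|slice false B|%:R / #|B|%:R) ^+ 2 *
                  (\sum_x charfun_sq th (slice false B) x ^+ (2 * t)) +
               (#|slice true B|%:R / #|B|%:R) ^+ 2 *
                  (\sum_x charfun_sq th (slice true B) x ^+ (2 * t))).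
Proof.
move=> ineq g0 Bn0.
have N0 : #|B|%:R != 0 :> R by rewrite pnatr_eq0 cards_eq0.
set N : R := #|B|%:R in N0 *.
have [a aE] : {a : R | a = #|slice false B|%:R / N} by exists (#|slice false B|%:R / N).
have [b bE] : {b : R | b = #|slice true B|%:R / N} by exists (#|slice true B|%:R / N).
rewrite -aE -bE.
have ab : a + b = 1 by rewrite aE bE -mulrDl -natrD -card_slice divff.
have a0 : 0 <= a by rewrite aE divr_ge0.
have b0 : 0 <= b by rewrite bE divr_ge0.
rewrite sum_cube_cons -big_split !mulr_sumr -big_split mulr_sumr; apply: ler_sum => x _ /=.
pose X := Num.sqrt (charfun_sq th (slice false B) x).
pose Y := Num.sqrt (charfun_sq th (slice true B) x).
have X0 : 0 <= X by rewrite sqrtr_ge0.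
have Y0 : 0 <= Y by rewrite sqrtr_ge0.
have XE : X ^+ 2 = charfun_sq th (slice false B) x by rewrite sqr_sqrtr ?charfun_sq_ge0.
have YE : Y ^+ 2 = charfun_sq th (slice true B) x by rewrite sqr_sqrtr ?charfun_sq_ge0.
rewrite -XE -YE -!exprM mulnA; apply: le_trans (ineq a b X Y a0 b0 ab X0 Y0).
have -> : (4 * t = 2 * (2 * t))%N by rewrite mulnA.
have -> : a ^+ 2 * X ^+ 2 = (a * X) ^+ 2 by rewrite exprMn.
have -> : b ^+ 2 * Y ^+ 2 = (b * Y) ^+ 2 by rewrite exprMn.
have -> : a * b * X * Y = (a * X) * (b * Y) by ring.
set C0 := cos_sum th (slice false B) x; set S0 := sin_sum th (slice false B) x.
set C1 := cos_sum th (slice true B) x; set S1 := sin_sum th (slice true B) x.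
have UE : (a * X) ^+ 2 = (C0 / N) ^+ 2 + (S0 / N) ^+ 2.
  by rewrite !expr_div_n -mulrDl -charfun_sqM -XE aE; field.
have VE : (b * Y) ^+ 2 = (C1 / N) ^+ 2 + (S1 / N) ^+ 2.
  by rewrite !expr_div_n -mulrDl -charfun_sqM -YE bE; field.
apply: le_trans (sum_two_phases (2 * t) (cos2Dsin2 th) g0 _ _ UE VE); rewrite ?mulr_ge0 //.
rewrite /charfun_sq !cos_sum_cons !sin_sum_cons -/C0 -/C1 -/S0 -/S1 -/N expr0 expr1 !mul1r !mulN1r.
rewrite le_eqVlt; apply/orP; left; apply/eqP; congr (_ ^+ _ + _ ^+ _); field; exact: N0.
Qed.

(** The squared weights make the induction close: [(|B_b| / |B|)^2] times the bound [1 / |B_b|] for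
    a slice is [|B_b| / |B|^2], and these add up to [1 / |B|]. *)
Lemma charfun_moment (R : realType) (eta : R) : 1 < eta ->
  exists2 K : R, 0 < K & forall (t n : nat) (th : R) (B : {set cube n}),
    0 <= cos th ^+ 2 - sin th ^+ 2 ->
    K <= t%:R * (1 - (cos th ^+ 2 - sin th ^+ 2)) ->
    \sum_x charfun_sq th B x ^+ (2 * t) <= (2 * eta) ^+ n / #|B|%:R.
Proof.
move=> eta1; have [K K0 ineq] := two_point eta1; exists K => // t n th B g0 Kt.
have eta0 : 0 < eta by apply: lt_trans eta1.
(* For [t = 0] the moment of an empty set would count every [x] instead of being 0. *)
have t0 : (0 < t)%N.
  by rewrite lt0n; apply: contraTneq Kt => ->; rewrite mul0r -ltNge.
have g1 : cos th ^+ 2 - sin th ^+ 2 <= 1.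
  by rewrite -[leRHS](cos2Dsin2 th) lerBlDr -addrA lerDl addr_ge0 ?sqr_ge0.
have {}ineq := ineq t (cos th ^+ 2 - sin th ^+ 2).
have charfun0 m (x : cube m) : charfun_sq th finset.set0 x ^+ (2 * t) = 0.
  by rewrite /charfun_sq cards0 expr0n /= invr0 mulr0 expr0n muln_eq0 (gtn_eqF t0).
elim: n B => [|n IHn] B.
  have [->|Bn0] := eqVneq B finset.set0.
    by rewrite big1 ?cards0 ?invr0 ?mulr0 // => x _; rewrite charfun0.
  have card0 : #|cube 0| = 1%N by rewrite card_ffun card_bool card_ord.
  have B1 : #|B| = 1%N.
    by apply/eqP; rewrite eqn_leq card_gt0 Bn0 andbT -card0 max_card.
  rewrite expr0 B1 invr1 mulr1 -[leRHS]/(1%:R) -card0 -sum1_card natr_sum.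
  apply: ler_sum => x _.
  rewrite exprn_ile1 ?charfun_sq_ge0 // /charfun_sq B1 expr1n divr1.
  rewrite /cos_sum /sin_sum.
  under eq_bigr do rewrite /dotp big_ord0 mulr0 cos0.
  under [X in _ + X ^+ 2]eq_bigr do rewrite /dotp big_ord0 mulr0 sin0.
  by rewrite !sumr_const B1 mul0rn expr0n addr0 expr1n.
have [->|Bn0] := eqVneq B finset.set0.
  by rewrite big1 ?cards0 ?invr0 ?mulr0 // => x _; rewrite charfun0.
have N0 : #|B|%:R != 0 :> R by rewrite pnatr_eq0 cards_eq0.
apply: le_trans (charfun_moment_step (fun a b X Y => ineq a b X Y _ Kt) g0 Bn0) _.
  by rewrite g0.
rewrite [(2 * eta) ^+ n.+1]exprS -[leRHS]mulrA ler_wpM2l ?mulr_ge0 ?(ltW eta0) //.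
have part b : (#|slice b B|%:R / #|B|%:R) ^+ 2 *
      (\sum_x charfun_sq th (slice b B) x ^+ (2 * t)) <=
    (2 * eta) ^+ n * (#|slice b B|%:R / #|B|%:R ^+ 2).
  apply: le_trans (ler_wpM2l (sqr_ge0 _) (IHn (slice b B))) _.
  have [->|p0] := eqVneq (#|slice b B|%:R : R) 0; first by rewrite !mul0r expr0n !mul0r mulr0.
  rewrite le_eqVlt; apply/orP; left; apply/eqP; field; exact/andP.
apply: le_trans (lerD (part false) (part true)) _.
rewrite -mulrDr -mulrDl -natrD -card_slice le_eqVlt; apply/orP; left; apply/eqP.
by field.
Qed.

(** * Small angles *)

Lemma sin_mean_value (R : realType) (x : R) : 0 <= x ->
  exists2 c, 0 <= c <= x & sin x = cos c * x.
Proof.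
move=> x0; have [|c] := @MVT_segment R sin cos 0 x x0 (fun y _ => is_derive_sin y).
  exact/continuous_subspaceT/continuous_sin.
by rewrite in_itv /= sin0 !subr0 => cx ->; exists c.
Qed.

(** As [cos^2 - sin^2 = 1 - 2 sin^2], the claims are [2 sin^2 x <= 1] and [x^2 <= 2 sin^2 x]. The
    mean value theorem gives [sin x = x cos c], and [cos c >= 3/4] follows from the double angle
    formula at [c / 2]. *)
Lemma small_angle (R : realType) (x : R) : 0 <= x <= 1 / 2 ->
  0 <= cos x ^+ 2 - sin x ^+ 2 /\ x ^+ 2 <= 1 - (cos x ^+ 2 - sin x ^+ 2).
Proof.
move=> /andP[x0 x12].
have sin_sq (y : R) : 0 <= y -> sin y ^+ 2 <= y ^+ 2.
  move=> y0; have [c _ ->] := sin_mean_value y0.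
  rewrite exprMn ler_piMl ?sqr_ge0 // -(cos2Dsin2 c) lerDl; exact: sqr_ge0.
have dbl (y : R) : cos y ^+ 2 - sin y ^+ 2 = 1 - 2 * sin y ^+ 2.
  by have := cos2Dsin2 y; lra.
rewrite dbl; have hx := sin_sq x x0.
have x2 : x ^+ 2 <= 1 / 4 by rewrite expr2; nra.
split; first lra.
have [c /andP[c0 cx] sinE] := sin_mean_value x0.
have cosc : 3 / 4 <= cos c.
  have c20 : 0 <= c / 2 by lra.
  have -> : c = c / 2 + c / 2 by field.
  rewrite cosD -!expr2 dbl; have := sin_sq _ c20.
  have : (c / 2) ^+ 2 <= 1 / 8 by rewrite expr2; nra.
  lra.
have : 1 / 2 <= cos c ^+ 2 by rewrite expr2; nra.
have := sqr_ge0 x.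
rewrite sinE exprMn; nra.
Qed.

(** * From the characteristic function to point probabilities *)

(** The squared modulus of the sum of [exp(i j z)] over [j < J]: the right side shows its sign, the
    left side is linear in cosines and can be averaged over [B]. *)
Lemma fejer_kernel (R : realType) (J : nat) (z : R) :
  \sum_(i < J) \sum_(j < J) cos ((i%:R - j%:R) * z) =
  (\sum_(i < J) cos (i%:R * z)) ^+ 2 + (\sum_(i < J) sin (i%:R * z)) ^+ 2.
Proof.
rewrite !expr2 !mulr_suml -big_split; apply: eq_bigr => i _ /=.
rewrite !mulr_sumr -big_split; apply: eq_bigr => j _ /=.
by rewrite mulrBl cosB.
Qed.

(** With truncated subtraction, [(i - j) + (j - i)] is the distance of [i] and [j]. *)
Lemma cos_distn (R : realType) (i j : nat) (z : R) :
  cos ((i%:R - j%:R) * z) = cos (((i - j) + (j - i))%N%:R * z).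
Proof.
have [ij|/ltnW ji] := leqP i j.
  have -> : (i - j + (j - i) = j - i)%N by lia.
  by rewrite natrB // -cosN -mulNr opprB.
have -> : (i - j + (j - i) = i - j)%N by lia.
by rewrite natrB.
Qed.

Lemma geometric_le (R : realFieldType) (rho : R) (n : nat) : 0 <= rho < 1 ->
  \sum_(0 <= d < n) rho ^+ d <= (1 - rho)^-1.
Proof.
move=> /andP[r0 r1]; have p : 0 < 1 - rho by rewrite subr_gt0.
rewrite -[leRHS]mul1r ler_pdivlMr // big_mkord mulrC.
have := subrX1 rho n; have := exprn_ge0 n r0; lra.
Qed.

Lemma geometric_dist_le (R : realFieldType) (rho : R) (J i : nat) :
  0 <= rho < 1 -> (i < J)%N ->
  \sum_(j < J) rho ^+ ((i - j) + (j - i)) <= 2 / (1 - rho).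
Proof.
move=> r01 iJ; rewrite -(big_mkord xpredT (fun j => rho ^+ ((i - j) + (j - i)))).
rewrite (@big_cat_nat _ _ _ i) //=; last exact: ltnW.
rewrite mulr_natl mulr2n; apply: lerD.
  rewrite big_nat_rev /=; apply: le_trans (geometric_le i r01).
  rewrite !big_nat; apply: ler_sum => j /andP[_ ji].
  have -> : (i - (0 + i - j.+1) + (0 + i - j.+1 - i) = j.+1)%N by lia.
  case/andP: r01 => r0 r1; rewrite exprS ler_piMl ?exprn_ge0 //; exact: ltW.
rewrite -{1}[i]add0n big_addn; apply: le_trans (geometric_le (J - i) r01).
apply: ler_sum => j _.
by have -> : (i - (j + i) + (j + i - i) = j)%N by lia.
Qed.

(** The Fejer kernel at [phi (<x,y> - k)] is at least [J^2] on the fiber and nonnegative elsewhere.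
    Its sum over [B] involves the characteristic function only at the angles [d phi] with [d < J],
    so decay in [d] bounds each row by a geometric series. *)
Lemma card_fiber_le (R : realType) (n J : nat) (B : {set cube n}) (x : cube n)
    (phi rho : R) (k : int) :
  0 <= rho < 1 -> (0 < J)%N ->
  (forall d, (0 < d < J)%N -> charfun_sq (d%:R * phi) B x <= rho ^+ (2 * d)) ->
  #|[set y in B | dotp x y == k]|%:R <= 2 / (1 - rho) / J%:R * #|B|%:R :> R.
Proof.
move=> r01 J0 hchar; have /andP[r0 r1] := r01.
have Jp : 0 < J%:R :> R by rewrite ltr0n.
have char_le d : (d < J)%N -> charfun_sq (d%:R * phi) B x <= (rho ^+ d) ^+ 2.
  (* At [d = 0] the characteristic function is 1, or 0 if [B] is empty. *)
  move=> dJ; rewrite -exprM mulnC; case: d dJ => [|d] dJ; last exact: hchar.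
  rewrite mul0r muln0 expr0 /charfun_sq /cos_sum /sin_sum.
  under eq_bigr do rewrite mul0r cos0.
  under [X in _ + X ^+ 2]eq_bigr do rewrite mul0r sin0.
  rewrite big1_eq sumr_const expr0n addr0.
  have [->|h] := eqVneq (#|B|%:R ^+ 2 : R) 0; first by rewrite mul0r.
  by rewrite divff.
have cos_le (i j : 'I_J) : \sum_(y in B) cos ((i%:R - j%:R) * (phi * ((dotp x y)%:~R - k%:~R)))
    <= #|B|%:R * rho ^+ ((i - j) + (j - i)).
  under eq_bigr do rewrite cos_distn.
  have := ltn_ord i; have := ltn_ord j; set d := (_ + _)%N => jJ iJ.
  have {iJ jJ} : (d < J)%N by rewrite /d; lia.
  move=> /char_le; set th := d%:R * phi => h.
  (* The shift by [k] is a mere phase, which Cauchy-Schwarz removes. *)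
  have -> : \sum_(y in B) cos (d%:R * (phi * ((dotp x y)%:~R - k%:~R))) =
     cos_sum th B x * cos (th * k%:~R) + sin_sum th B x * sin (th * k%:~R).
    rewrite /cos_sum /sin_sum !mulr_suml -big_split; apply: eq_bigr => y _ /=.
    by rewrite mulrA mulrBr cosB.
  set S := _ + _.
  have S2 : S ^+ 2 <= (#|B|%:R * rho ^+ d) ^+ 2.
    rewrite exprMn; apply: le_trans (ler_wpM2l (sqr_ge0 _) h).
    rewrite charfun_sqM -[leRHS]mulr1 -(cos2Dsin2 (th * k%:~R)) -subr_ge0 /S.
    set a := cos_sum _ _ _; set b := sin_sum _ _ _; set u := cos _; set v := sin _.
    have -> : (a ^+ 2 + b ^+ 2) * (u ^+ 2 + v ^+ 2) - (a * u + b * v) ^+ 2 =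
      (a * v - b * u) ^+ 2 by ring.
    exact: sqr_ge0.
  apply: le_trans (ler_norm _) _.
  by rewrite -ler_sqr ?nnegrE ?mulr_ge0 ?exprn_ge0 // real_normK ?num_real.
rewrite mulrAC ler_pdivlMr //.
rewrite -(ler_pM2r Jp) -mulrA -expr2.
apply: (@le_trans _ _ (\sum_(i < J) \sum_(j < J) #|B|%:R * rho ^+ ((i - j) + (j - i)))).
  apply: (@le_trans _ _ (\sum_(i < J) \sum_(j < J) \sum_(y in B)
     cos ((i%:R - j%:R) * (phi * ((dotp x y)%:~R - k%:~R))))); last first.
    by apply: ler_sum => i _; apply: ler_sum => j _; apply: cos_le.
  under eq_bigr do rewrite exchange_big.
  rewrite exchange_big /= -sum1_card natr_sum mulr_suml.
  rewrite big_mkcond [leRHS]big_mkcond; apply: ler_sum => y _.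
  rewrite inE; case: (y \in B) => //=; rewrite fejer_kernel.
  case: eqP => [->|_]; last by rewrite addr_ge0 ?sqr_ge0.
  rewrite subrr mulr0.
  under eq_bigr do rewrite mulr0 cos0.
  by rewrite sumr_const card_ord mul1r lerDl sqr_ge0.
have -> : 2 / (1 - rho) * #|B|%:R * J%:R = \sum_(i < J) #|B|%:R * (2 / (1 - rho)).
  by rewrite sumr_const card_ord -[RHS]mulr_natr; ring.
apply: ler_sum => i _; rewrite -mulr_sumr ler_wpM2l //; exact: geometric_dist_le.
Qed.

(** * Counting directions with a large characteristic function *)

Lemma bernoulli_ge (R : realFieldType) (z : R) (n : nat) :
  -1 <= z -> 1 + n%:R * z <= (1 + z) ^+ n.
Proof.
move=> z1; elim: n => [|n IHn]; first by rewrite mul0r addr0 expr0.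
rewrite exprSr; apply: (@le_trans _ _ ((1 + n%:R * z) * (1 + z))); last first.
  by rewrite ler_wpM2r //; lra.
have : 0 <= n%:R * (z * z) by rewrite mulr_ge0 // -expr2 sqr_ge0.
rewrite -natr1; lra.
Qed.

Lemma exists_sqrtn (n : nat) : exists J : nat, (J ^ 2 <= n < J.+1 ^ 2)%N.
Proof.
elim: n => [|n [J /andP[Jn nJ]]]; first by exists 0%N.
have [h|h] := leqP (J.+1 ^ 2)%N n.+1; last by exists J; rewrite h andbT leqW.
by exists J.+1; rewrite h /=; move: nJ; rewrite !expnS !expn0; lia.
Qed.

Lemma markov_card (R : realFieldType) (T : finType) (f : T -> R) (c : R) (m : nat) :
  (forall x, 0 <= f x) -> 0 <= c ->
  #|[set x | c < f x]|%:R * c ^+ m <= \sum_x f x ^+ m.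
Proof.
move=> f0 c0; rewrite -sum1_card natr_sum mulr_suml big_mkcond /=.
apply: ler_sum => x _; rewrite inE.
case: ifP => [/ltW cx|_]; last by rewrite exprn_ge0.
by rewrite mul1r lerXn2r ?nnegrE.
Qed.

(** Markov's inequality for the moment of order [2 t] of [charfun_sq], with [t] of order
    [(J / d)^2]. One factor [eta^n] comes from the moment bound, the other from the threshold, whose
    power [rho^(4 d t)] is at least [eta^(- n)]. *)
Lemma large_charfun_card (R : realType) (eta : R) : 1 < eta ->
  exists2 rho : R, 0 <= rho < 1 &
    forall (n J d : nat) (B : {set cube n}), (J ^ 2 <= n)%N -> (0 < d < J)%N ->
    #|[set x | rho ^+ (2 * d) < charfun_sq (d%:R * (2 * J%:R)^-1) B x]|%:R * #|B|%:R
      <= 2 ^+ n * eta ^+ (2 * n) :> R.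
Proof.
move=> eta1; have [K0 K0p moment] := charfun_moment eta1.
have eta0 : 0 < eta by apply: lt_trans eta1.
(* The factor 4 makes up for the 2 in [th = d / (2 J)]. *)
pose K := (Num.truncn (4 * K0)).+1.
have KK : 4 * K0 <= K%:R.
  by apply: ltW; apply: truncnS_gt.
have L0 : 0 < (16 * K)%:R :> R by rewrite ltr0n.
have iv1 : eta^-1 < 1 by rewrite invf_lt1.
have iv0 : 0 < eta^-1 by rewrite invr_gt0.
(* Chosen so that Bernoulli's inequality gives [(1 - z)^(16 K) >= 1 - 16 K z = 1 / eta]. *)
pose z := (1 - eta^-1) / (16 * K)%:R.
have z0 : 0 < z by rewrite divr_gt0 ?subr_gt0.
have zL : (16 * K)%:R * z = 1 - eta^-1 by rewrite /z mulrC divfK // gt_eqF.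
have z1 : z < 1.
  have : z <= (16 * K)%:R * z by rewrite ler_peMl ?(ltW z0) // ler1n.
  lra.
pose rho := 1 - z.
have r0 : 0 <= rho by rewrite /rho; lra.
have r1 : rho <= 1 by rewrite /rho; lra.
exists rho; first by rewrite r0 /rho /=; lra.
have rhoL : eta^-1 <= rho ^+ (16 * K).
  have zN : -1 <= - z by lra.
  have := bernoulli_ge (16 * K) zN; rewrite mulrN zL -/rho; lra.
move=> n J d B Jn /andP[d0 dJ].
have J0 : (0 < J)%N by apply: leq_ltn_trans dJ.
have Jp : 0 < J%:R :> R by rewrite ltr0n.
set q := (J %/ d).+1.
have dq1 : (J <= d * q)%N by rewrite ltnW // mulnC ltn_ceil.
have dq2 : (d * q <= 2 * J)%N.
  by rewrite /q mulnS (mulnC d) mul2n -addnn leq_add ?leq_trunc_div // ltnW.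
(* q is of order J / d, so that t th^2 is bounded below while t is O(n / d^2). *)
pose t := (K * q ^ 2)%N.
set th := d%:R * (2 * J%:R)^-1.
have th12 : 0 <= th <= 1 / 2.
  rewrite mulr_ge0 ?invr_ge0 ?mulr_ge0 //=.
  rewrite /th invfM mulrA mulrAC ler_pM2r ?invr_gt0 // ler_pdivrMr // mul1r ler_nat.
  exact: ltnW.
have [g0 th2] := small_angle th12.
have tth : K0 <= t%:R * (1 - (cos th ^+ 2 - sin th ^+ 2)).
  apply: le_trans (ler_wpM2l _ th2); last by rewrite ler0n.
  have -> : t%:R * th ^+ 2 = K%:R / 4 * ((d * q)%:R / J%:R) ^+ 2.
    by rewrite /t /th !natrM; field; rewrite gt_eqF.
  have : 1 <= (d * q)%:R / J%:R :> R by rewrite ler_pdivlMr // mul1r ler_nat.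
  move=> /(@exprn_ege1 _ 2) h; have : K0 <= K%:R / 4 by lra.
  move=> h1; apply: le_trans h1 _; rewrite ler_peMr //; lra.
have m := moment t n th B g0 tth.
have Bp : 0 <= #|B|%:R :> R by [].
have := markov_card (2 * t) (charfun_sq_ge0 th B) (exprn_ge0 (2 * d) r0).
set N := #|_|%:R => mk.
(* Bounding [d] by [d^2] is wasteful, but decay like [rho^d] is all that the geometric series
   requires. *)
have expo : (2 * d * (2 * t) <= 16 * K * n)%N.
  have : (d * q ^ 2 <= 4 * n)%N.
    apply: (@leq_trans ((d * q) ^ 2)); first by rewrite expnMn leq_mul // -{1}[d]expn1 leq_pexp2l.
    apply: (@leq_trans ((2 * J) ^ 2)); first by rewrite leq_exp2r.
    by rewrite expnMn leq_mul.
  rewrite /t (_ : 2 * d * (2 * (K * q ^ 2)) = 4 * K * (d * q ^ 2))%N; last by ring.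
  by move=> h; rewrite (_ : 16 * K * n = 4 * K * (4 * n))%N ?leq_mul2l ?h ?orbT //; ring.
have low : (eta ^+ n)^-1 <= (rho ^+ (2 * d)) ^+ (2 * t).
  apply: (@le_trans _ _ (rho ^+ (16 * K * n))).
    by rewrite exprM -exprVn lerXn2r ?nnegrE ?exprn_ge0 // ltW.
  by rewrite -exprM ler_wiXn2l.
have NB : N * (eta ^+ n)^-1 <= (2 * eta) ^+ n / #|B|%:R.
  by apply: le_trans m; apply: le_trans mk; rewrite ler_wpM2l.
have en0 : 0 < eta ^+ n by rewrite exprn_gt0.
have [Bz|Bn0] := eqVneq (#|B|%:R : R) 0.
  by rewrite Bz mulr0 mulr_ge0 ?exprn_ge0 // ltW.
have {}Bp : 0 < #|B|%:R :> R by rewrite lt_neqAle eq_sym Bn0.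
move: NB; rewrite ler_pdivrMr // mulrAC ler_pdivlMr //.
by rewrite exprMn -mulrA -exprD addnn -mul2n.
Qed.

(** * Anticoncentration outside few directions *)

(** A union bound over the angles [d / (2 J)] with [0 < d < J]. With [eta = 2^(delta / 4)], the
    allowance [2^(delta n) = eta^(4 n)] covers [eta^(2 n)] for each angle and [J <= eta^(2 n)] for
    their number. *)
Lemma anticoncentration_most (R : realType) (delta : R) : 0 < delta ->
  exists2 C : R, 0 < C & forall (n : nat) (B : {set cube n}), (0 < n)%N ->
    exists Z : {set cube n},
      #|Z|%:R * #|B|%:R <= 2 ^+ n * 2 `^ (delta * n%:R) /\
      forall x, x \notin Z -> forall k : int,
        #|[set y in B | dotp x y == k]|%:R <= C / Num.sqrt n%:R * #|B|%:R.
Proof.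
move=> delta0; pose eta : R := 2 `^ (delta / 4).
have eta1 : 1 < eta.
  have h : (1 : R) `^ (delta / 4) < eta by rewrite gt0_ltr_powR ?divr_gt0 ?nnegrE ?ltr1n.
  by rewrite powR1 in h.
have etaE n : eta ^+ (4 * n) = 2 `^ (delta * n%:R).
  by rewrite -powR_mulrn ?powR_ge0 // -powRrM natrM; congr (_ `^ _); field.
have [rho r01 large] := large_charfun_card eta1.
have /andP[r0 r1] := r01.
(* From [n0] on, [n (eta - 1)^2 >= 1], hence [n <= (n (eta - 1))^2 <= eta^(2 n)]. For smaller [n],
   the entry [sqrt n0] of [C] makes the claim trivial. *)
pose n0 := (Num.truncn (((eta - 1) ^+ 2)^-1)).+1.
exists (Num.max (Num.sqrt n0%:R) (4 / (1 - rho))).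
  by rewrite lt_max divr_gt0 ?orbT ?subr_gt0.
set C := Num.max _ _.
move=> n B n_gt0.
have sn : 0 < Num.sqrt n%:R :> R by rewrite sqrtr_gt0 ltr0n.
have [n_small|n_large] := ltnP n n0.
  exists finset.set0; rewrite cards0 mul0r mulr_ge0 ?exprn_ge0 ?powR_ge0 //; split => // x _ k.
  rewrite -[leLHS]mul1r ler_pM //; last first.
    by rewrite ler_nat subset_leq_card //; apply/fintype.subsetP => y; rewrite inE => /andP[].
  rewrite ler_pdivlMr // mul1r le_max; apply/orP; left.
  by rewrite ler_wsqrtr // ler_nat ltnW.
have [J /andP[Jn nJ]] := exists_sqrtn n.
have J0 : (0 < J)%N by case: J nJ {Jn} => //; rewrite exp1n; lia.
pose Z d := [set x | rho ^+ (2 * d) < charfun_sq (d%:R * (2 * J%:R)^-1) B x].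
exists (\bigcup_(d < J | (0 < d)%N) Z d); split.
  have card_le : (#|\bigcup_(d < J | (0 < d)%N) Z d| <= \sum_(d < J | (0 < d)%N) #|Z d|)%N.
    elim/big_rec2: _ => [|d m A _ Am]; first by rewrite cards0.
    by apply: leq_trans (leq_card_setU _ _) _; rewrite leq_add2l.
  have J_le : J%:R <= eta ^+ (2 * n).
    have e1 : -1 <= eta - 1 by lra.
    have := bernoulli_ge n e1; rewrite [1 + (eta - 1)]addrC subrK => bern.
    apply: (@le_trans _ _ n%:R).
      by rewrite ler_nat; apply: leq_trans Jn; rewrite expnS expn1 leq_pmull.
    rewrite mulnC exprM.
    have e10 : 0 < (eta - 1) ^+ 2 by rewrite exprn_gt0 // subr_gt0.
    have big1n : 1 <= n%:R * (eta - 1) ^+ 2.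
      rewrite -ler_pdivrMr // mul1r; apply: ltW.
      apply: (@lt_le_trans _ _ n0%:R); first exact: truncnS_gt.
      by rewrite ler_nat.
    apply: (@le_trans _ _ ((n%:R * (eta - 1)) ^+ 2)).
      by rewrite exprMn expr2 -mulrA ler_peMr.
    rewrite lerXn2r ?nnegrE ?mulr_ge0 ?exprn_ge0 ?subr_ge0 ?(ltW eta1) //.
      by apply: ltW; apply: lt_trans eta1.
    by apply: le_trans bern; rewrite lerDr.
  apply: (@le_trans _ _ (\sum_(d < J | (0 < d)%N) #|Z d|%:R * #|B|%:R)).
    by rewrite -mulr_suml -natr_sum ler_wpM2r // ler_nat.
  apply: (@le_trans _ _ (\sum_(d < J) 2 ^+ n * eta ^+ (2 * n))).
    rewrite big_mkcond; apply: ler_sum => d _; case: ifP => [d0|_].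
      by apply: large => //; rewrite d0 /=.
    by rewrite mulr_ge0 ?exprn_ge0 // powR_ge0.
  rewrite sumr_const card_ord -[leLHS]mulr_natr -mulrA ler_wpM2l ?exprn_ge0 //.
  rewrite -etaE (_ : 4 * n = 2 * n + 2 * n)%N; last by lia.
  by rewrite exprD ler_wpM2l // exprn_ge0 // powR_ge0.
move=> x xZ k.
have small d : (0 < d < J)%N -> charfun_sq (d%:R * (2 * J%:R)^-1) B x <= rho ^+ (2 * d).
  move=> /andP[d0 dJ]; rewrite leNgt; apply: contra xZ => h.
  by apply/bigcupP; exists (Ordinal dJ) => //; rewrite inE.
apply: le_trans (card_fiber_le k r01 J0 small) _.
rewrite ler_wpM2r // ler_pdivlMr // mulrAC ler_pdivrMr ?ltr0n //.
apply: (@le_trans _ _ (4 / (1 - rho) * J%:R)); last by rewrite ler_wpM2r // le_max lexx orbT.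
(* The second entry of [C] is twice the constant of [card_fiber_le], since
   [sqrt n <= J + 1 <= 2 J]. *)
have -> : 4 / (1 - rho) * J%:R = 2 / (1 - rho) * (2 * J%:R) by ring.
rewrite ler_wpM2l ?divr_ge0 ?subr_ge0 ?(ltW r1) //.
have -> : 2 * J%:R = Num.sqrt ((2 * J%:R) ^+ 2) :> R by rewrite sqrtr_sqr ger0_norm ?mulr_ge0.
rewrite ler_wsqrtr // -natrM -natrX ler_nat.
by move: nJ; rewrite !expnS !expn0; nia.
Qed.

(** * From cardinalities to probabilities *)

Theorem theorem2 (R : realType) (beta delta : R)
    (beta_gt0 : 0 < beta) (delta_gt0 : 0 < delta) :
  exists C : R, 0 < C /\
    forall n : nat, (0 < n)%N ->
    forall B : {set cube n}, #|B|%:R = 2 `^ (beta * n%:R) :> R ->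
      (#|[set x : cube n |
            ~~ (max_point_prob (uniform_law R B) (fun y => dotp x y)
                  <= C / Num.sqrt n%:R)]|%:R
         <= 2 `^ (n%:R * (1 - beta + delta)) :> R)
      /\
      (forall A : {set cube n},
         #|A|%:R = 2 `^ (n%:R * (1 - beta + 2 * delta)) :> R ->
         max_point_prob (indep_law (uniform_law R A) (uniform_law R B))
             (fun p => dotp p.1 p.2)
           <= C / Num.sqrt n%:R + 2 `^ (- delta * n%:R)).
Proof.
have [C C0 anti] := anticoncentration_most delta_gt0.
exists C; split=> // n n0 B BE.
have [Z [Zcard Zanti]] := anti n B n0.
have two0 : (2 : R) != 0 by rewrite pnatr_eq0.
have B0 : 0 < #|B|%:R :> R by rewrite BE powR_gt0.
have Z_le : #|Z|%:R <= 2 `^ (n%:R * (1 - beta + delta)) :> R.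
  move: Zcard; rewrite -ler_pdivlMr // => /le_trans; apply.
  rewrite BE -powRN -powR_mulrn // -!powRD ?two0 ?implybT //.
  by rewrite le_eqVlt; apply/orP; left; apply/eqP; congr (_ `^ _); ring.
have prE x k : Pr (uniform_law R B) (fun y => dotp x y == k) =
    #|[set y in B | dotp x y == k]|%:R / #|B|%:R.
  rewrite /Pr /uniform_law -big_mkcondr /= sumr_const -[RHS]mulrC mulr_natr.
  by congr (_ *+ _); apply: eq_card => y; rewrite !inE andbC.
have pr_le x k : x \notin Z ->
    Pr (uniform_law R B) (fun y => dotp x y == k) <= C / Num.sqrt n%:R.
  by move=> /Zanti/(_ k); rewrite prE ler_pdivrMr.
have pr_le1 x k : Pr (uniform_law R B) (fun y => dotp x y == k) <= 1.
  rewrite prE ler_pdivrMr // mul1r ler_nat subset_leq_card //.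
  by apply/fintype.subsetP => y; rewrite inE => /andP[].
have sup_le (T : finType) (mu : T -> R) (f : T -> int) (c : R) :
    (forall k, Pr mu (fun t => f t == k) <= c) -> max_point_prob mu f <= c.
  move=> h; apply: ge_sup; last by move=> _ [k _ <-].
  by exists (Pr mu (fun t => f t == 0)), 0.
split.
  apply: le_trans Z_le; rewrite ler_nat subset_leq_card //.
  apply/fintype.subsetP => x; rewrite inE; apply: contraR => xZ.
  by apply: sup_le => k; apply: pr_le.
move=> A AE; apply: sup_le => k.
have A0 : 0 < #|A|%:R :> R by rewrite AE powR_gt0.
set E := C / _.
have E0 : 0 <= E by rewrite divr_ge0 ?sqrtr_ge0 // ltW.
(* Conditioning on the value of [X]. *)
have -> : Pr (indep_law (uniform_law R A) (uniform_law R B)) (fun t => dotp t.1 t.2 == k) =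
    \sum_(x in A) #|A|%:R^-1 * Pr (uniform_law R B) (fun y => dotp x y == k).
  rewrite /Pr /indep_law big_mkcond.
  rewrite -(pair_bigA _ (fun x y => if dotp x y == k then
     uniform_law R A x * uniform_law R B y else 0)) /= [RHS]big_mkcond.
  apply: eq_bigr => x _; rewrite -big_mkcond /= -mulr_sumr {1}/uniform_law.
  by case: ifP => // _; rewrite mul0r.
rewrite -mulr_sumr mulrC ler_pdivrMr //.
(* A direction outside [Z] contributes at most [E], one in [Z] at most 1, and
   [|Z| / |A| <= 2^(- delta n)]. *)
apply: (@le_trans _ _ (\sum_(x in A) (E + (x \in Z)%:R))).
  apply: ler_sum => x _; case: (boolP (x \in Z)) => xZ.
    by apply: le_trans (pr_le1 x k) _; rewrite lerDr.
  by rewrite addr0 pr_le.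
rewrite big_split /= sumr_const -[E *+ _]mulr_natr mulrDl lerD2l.
apply: (@le_trans _ _ #|Z|%:R).
  rewrite -sum1_card natr_sum [leRHS]big_mkcond [leLHS]big_mkcond /=.
  by apply: ler_sum => x _; case: (x \in A); case: (x \in Z).
apply: le_trans Z_le _; rewrite AE -powRD ?two0 ?implybT //.
by rewrite le_eqVlt; apply/orP; left; apply/eqP; congr (_ `^ _); ring.
Qed.
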